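(* For every integer $r\ge 1$ there exist constants $c,C>0$ depending only on $r$ such that for all integers $t,k,n$ with $0\le t\le r-1$, $n\ge r$ and $2\le k\le n$ the following holds. If $t\le \frac{r-1}{2}$, then $$c\, n^{r-t-1}k^{t+1}\le \mathrm{ex}(n,\mathcal{S}^{(r)}_t(k))\le C\, n^{r-t-1}k^{t+1},$$ and if $t>\frac{r-1}{2}$, then $$c\, n^{t}k^{r-t}\le \mathrm{ex}(n,\mathcal{S}^{(r)}_t(k))\le C\, n^{t}k^{r-t}.$$
   Context: An $r$-uniform hypergraph (or $r$-graph) on a finite vertex set $V$ is a family of $r$-element subsets of $V$, called edges. $\mathcal{S}^{(r)}_t(k)$ denotes the $r$-uniform sunflower with $k$ petals and kernel of size $t$: the $r$-uniform hypergraph with $k$ distinct edges $A_1,\dots,A_k$, each of size $r$, for which there is a set $C$ (the kernel) with $|C|=t$, $C\subseteq A_i$ for all $i$, and the petals $A_i\setminus C$ pairwise disjoint. For an $r$-graph $\mathcal{H}$, the Turán number $\mathrm{ex}(n,\mathcal{H})$ is the maximum number of edges in an $r$-uniform hypergraph on $n$ vertices which does not contain a copy of $\mathcal{H}$ as a subhypergraph. *)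

(* Defs.v *)
From mathcomp Require Import all_boot all_order all_algebra.
From mathcomp Require Import reals.

Set Implicit Arguments.
Unset Strict Implicit.
Unset Printing Implicit Defensive.

Definition uniform (T : finType) (r : nat) (G : {set {set T}}) : bool :=
  [forall e in G, #|e| == r].

(* A hypergraph is identified with its family of edges, so an embedding only
   has to be injective on the vertices covered by the edges of H; isolated
   points of the ambient type of H are irrelevant. *)
Definition contains_copy (T U : finType)
    (H : {set {set T}}) (G : {set {set U}}) : bool :=
  [exists f : {ffun T -> U},
    [forall x in cover H, forall y in cover H, (f x == f y) ==> (x == y)] &&
    [forall e in H, f @: e \in G]].

(* If every G contains a copy of H, this is a maximum over the empty range,
   i.e. 0; this only happens when H has no edges. *)
Definition turan (T : finType) (r n : nat) (H : {set {set T}}) : nat :=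
  \max_(G : {set {set 'I_n}} | uniform r G && ~~ contains_copy H G) #|G|.

(* H is the r-uniform sunflower with k petals and kernel of size t, which is
   determined by (r, t, k) up to isomorphism. *)
Definition is_sunflower (T : finType) (r t k : nat) (H : {set {set T}}) : Prop :=
  exists A : 'I_k -> {set T},
    [/\ H = [set A i | i : 'I_k],
        injective A,
        forall i, #|A i| = r
      & exists C : {set T},
          [/\ #|C| = t,
              forall i, C \subset A i
            & forall i j, i != j -> [disjoint A i :\: C & A j :\: C]]].

Lemma sunflower_exists (r t k : nat) : t < r ->
  exists (T : finType) (H : {set {set T}}), is_sunflower r t k H.
Proof.
move=> ltr; pose T : finType := ('I_t + 'I_k * 'I_(r - t))%type.
pose C : {set T} := [set inl c | c : 'I_t].
pose P (i : 'I_k) : {set T} := [set inr (i, j) | j : 'I_(r - t)].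
have inP i i' j : (inr (i', j) \in P i) = (i' == i).
  apply/imsetP/eqP => [[j' _ [-> _]] // | ->]; by exists j.
have dCP i : [disjoint C & P i].
  apply/pred0P => x /=; apply/negbTE/negP => /andP[/imsetP[c _ ->]].
  by case/imsetP.
have rC i j : inr (i, j) \notin C by apply/imsetP; case.
have DP i : (C :|: P i) :\: C = P i.
  rewrite setDUl setDv set0U; apply/setDidPl; by rewrite disjoint_sym.
exists T, [set C :|: P i | i : 'I_k], (fun i => C :|: P i); split=> //.
- move=> i i' eqA; have j : 'I_(r - t) by exists 0; rewrite subn_gt0.
  have /setP/(_ (inr (i, j))) := eqA.
  by rewrite !in_setU (negbTE (rC i j)) !inP eqxx => /esym/eqP.
- move=> i; rewrite cardsU (_ : C :&: P i = set0); last first.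
    by apply/eqP; rewrite setI_eq0.
  rewrite cards0 subn0 !card_imset ?card_ord ?subnKC // 1?ltnW //.
    by move=> j j' [].
  by move=> c c' [].
exists C; split=> [|i|i j neq].
- by rewrite card_imset ?card_ord // => c c' [].
- exact: subsetUl.
rewrite !DP; apply/pred0P => x /=; apply/negbTE/negP => /andP[/imsetP[l _ ->]].
by rewrite inP (negbTE neq).
Qed.

(* Main.v *)
(** The governing exponent is M = max(t, r - t - 1): both cases of the theorem
    say that the Turan number has order n^M k^(r - M).

    Upper bound.  Order the vertices of each edge, so that edges become
    functions p on r positions.  A set S of positions is a kernel at p when the
    edges agreeing with p on S cannot be covered, outside S, by r k vertices; a
    kernel of size t yields a sunflower greedily.  Peeling off links that are
    not kernels reduces, up to a factor depending on r, to a family whose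
    kernels form the same set J of subsets of the positions at every edge.  For
    such a family J is closed under intersection: starting from an edge through
    A :&: B, change it off B and then off A, avoiding a given cover both times.
    A closed J without members of size t leaves some M-set S whose only
    superset in J is the full set (by the Frankl-Katona theorem), and then an
    edge is found from S (at most n^M choices) by repeatedly adding a vertex of
    a small cover (O(k) choices each time).

    Lower bounds.  If every edge has more than t points in a fixed set of size
    max(k - 1, t + 1), no sunflower has a kernel of size t.  Otherwise blow up,
    with classes of size at most k - 1, a family of r-sets meeting pairwise in
    fewer than t points: a kernel of size t determines the projection of all
    petals to one edge, so the petals compete for the vertices of one class. *)

Require Import Defs.
From mathcomp Require Import all_boot all_order all_algebra.
From mathcomp Require Import reals.
From mathcomp Require Import zify ring.
Import Order.TTheory GRing.Theory Num.Theory.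

Set Implicit Arguments.
Unset Strict Implicit.
Unset Printing Implicit Defensive.

(** * A spanning set for an intersection-closed family *)

Lemma exists_subset_card (T : finType) (A : {set T}) (m : nat) :
  m <= #|A| -> exists2 S : {set T}, S \subset A & #|S| = m.
Proof.
case/card_geqP => s [us <- sA]; exists [set x in s].
  by apply/subsetP => x; rewrite inE => /sA.
by rewrite cardsE (card_uniqP us).
Qed.

(* If the degree never dropped, giving each pair (y, x) the weight 1 / deg y
   would yield #|L| <= #|R|. *)
Lemma exists_degree_lt (T U : finType) (L : {set T}) (R : {set U})
    (d : T -> U -> bool) :
  #|R| < #|L| -> (forall y, y \in L -> exists2 x, x \in R & d y x) ->
  exists y x, [/\ y \in L, x \in R, d y x &
    #|[set z in R | d y z]| < #|[set z in L | d z x]|].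
Proof.
move=> ltRL dL.
case: (boolP [exists y in L, exists x in R, d y x &&
   (#|[set z in R | d y z]| < #|[set z in L | d z x]|)]).
  case/exists_inP=> y yL /exists_inP[x xR /andP[dyx lt]].
  by exists y, x.
rewrite negb_exists_in => /forall_inP hN.
have le (y : T) (x : U) : y \in L -> x \in R -> d y x ->
    #|[set z in L | d z x]| <= #|[set z in R | d y z]|.
  move=> yL xR dyx; rewrite leqNgt; apply/negP => lt.
  have /negP[] := hN _ yL; apply/exists_inP; exists x => //.
  by rewrite dyx lt.
pose w (a : nat) : rat := (a%:R^-1)%R.
have sumL : (\sum_(y in L) \sum_(x in R | d y x)
    w #|[set z in R | d y z]| = #|L|%:R)%R.
  rewrite -sumr_const; apply: eq_bigr => y yL.
  rewrite (eq_bigl (fun x => x \in [set z in R | d y z])); last first.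
    by move=> x; rewrite inE.
  rewrite sumr_const /w -(mulr_natl (_^-1)%R) mulfV // pnatr_eq0 -lt0n.
  have [x xR dyx] := dL y yL.
  by apply/card_gt0P; exists x; rewrite inE xR.
have sumR : (\sum_(x in R) \sum_(y in L | d y x)
    w #|[set z in L | d z x]| <= #|R|%:R)%R.
  rewrite -sumr_const; apply: ler_sum => x xR.
  rewrite (eq_bigl (fun y => y \in [set z in L | d z x])); last first.
    by move=> y; rewrite inE.
  rewrite sumr_const /w -(mulr_natl (_^-1)%R).
  case: #|_| => [|a]; first by rewrite mul0r ler01.
  by rewrite mulfV // pnatr_eq0.
have : (#|L|%:R <= #|R|%:R :> rat)%R.
  rewrite -sumL; apply: le_trans sumR.
  rewrite (exchange_big_dep (fun x => x \in R)) /=; last by move=> ? ? _ /andP[].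
  apply: ler_sum => x xR.
  rewrite (eq_bigl (fun y => (y \in L) && d y x)); last first.
    by move=> y; rewrite xR.
  apply: ler_sum => y /andP[yL dyx].
  have gt0 : 0 < #|[set z in L | d z x]|.
    by apply/card_gt0P; exists y; rewrite inE yL.
  rewrite /w lef_pV2 ?posrE ?ltr0n ?ler_nat ?le //.
  exact: leq_trans (le _ _ yL xR dyx).
by rewrite ler_nat leqNgt ltRL.
Qed.

Definition nbh (T U : finType) (e : T -> U -> bool) (R : {set U})
    (I : {set T}) : {set U} :=
  [set x in R | [exists i in I, e i x]].

(* Equivalent, after complementing the sets, to the theorem of Frankl and
   Katona on families in which no s members meet in exactly s - 1 points.  In
   the main case k = #|R| + 1, pick y and x not adjacent with deg x <= deg y:
   put y in I, and discard x together with its neighbours. *)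
Lemma exists_card_nbh (T U : finType) (e : T -> U -> bool)
    (L : {set T}) (R : {set U}) (k : nat) :
  #|R| < k <= #|L| ->
  exists2 I : {set T}, I \subset L & #|I| + #|nbh e R I| = k.
Proof.
have [m] := ubnP #|L|; elim: m => // m IHm in L R k *.
rewrite ltnS => leLm /andP[ltRk lekL].
(* Induction step: [y] joins [I] and its neighbours leave [R], so the target drops by the degree of
   [y] plus one. Any other point discarded from [R] must have no neighbour in [L'], so that it never
   belongs to the final neighbourhood. *)
have addy (y : T) (L' : {set T}) (R' : {set U}) :
    y \in L -> L' \subset L :\ y -> R' \subset [set x in R | ~~ e y x] ->
    (forall z x, z \in L' -> x \in R -> ~~ e y x -> x \notin R' -> ~~ e z x) ->
    #|R'| + #|[set x in R | e y x]|.+1 < k <= #|L'| + #|[set x in R | e y x]|.+1 ->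
  exists2 I : {set T}, I \subset L & #|I| + #|nbh e R I| = k.
  move=> yL sL' sR' sep /andP[ltk lek].
  have [||I' sI' eqk] := IHm L' R' (k - #|[set x in R | e y x]|.+1).
  - by have := subset_leq_card sL'; have := cardsD1 y L; rewrite yL; lia.
  - by lia.
  have sI := subset_trans sI' sL'.
  exists (y |: I'); first by rewrite subUset sub1set yL (subset_trans sI) ?subD1set.
  have -> : nbh e R (y |: I') = [set x in R | e y x] :|: nbh e R' I'.
    apply/setP => x; rewrite !inE; apply/andP/orP.
      case=> xR /exists_inP[i]; rewrite !inE => /orP[/eqP-> eyx|iI' eix].
        by left; rewrite xR.
      case: (boolP (e y x)) => [eyx|neyx]; [by left; rewrite xR | right].
      apply/andP; split; last by apply/exists_inP; exists i.
      apply: contraLR eix => xR'; apply: sep => //.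
      exact: (subsetP sI').
    case=> [/andP[xR eyx]|/andP[xR' /exists_inP[i iI' eix]]].
      by split=> //; apply/exists_inP; exists y; rewrite ?setU11.
    have := subsetP sR' x xR'; rewrite inE => /andP[-> _]; split=> //.
    by apply/exists_inP; exists i; rewrite // setU1r.
  rewrite cardsU1 (_ : y \notin I'); last first.
    by apply/negP => /(subsetP sI); rewrite !inE eqxx.
  rewrite cardsU (_ : _ :&: _ = set0) ?cards0; last first.
    apply/setP => x; rewrite !inE; apply/negbTE/negP =>
      /andP[/andP[xR eyx] /andP[xR' _]].
    by have := subsetP sR' x xR'; rewrite inE eyx andbF.
  by rewrite /=; lia.
have cardR y : #|R| = #|[set x in R | e y x]| + #|[set x in R | ~~ e y x]|.
  rewrite -cardsUI (_ : _ :&: _ = set0) ?cards0 ?addn0; last first.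
    by apply/setP => x; rewrite !inE; case: (e y x); rewrite ?andbF.
  congr #|pred_of_set _|; apply/setP=> x; rewrite !inE.
  by case: (e y x); rewrite /= ?andbT ?andbF ?orbF.
have L0 : 0 < #|L| by lia.
have [y0 y0L] := card_gt0P L0.
have [ltk|] := ltnP #|R|.+1 k.
  apply: (addy y0 (L :\ y0) [set x in R | ~~ e y0 x]) => //.
    by move=> z x zL xR neyx; rewrite inE xR neyx.
  by have := cardsD1 y0 L; have := cardR y0; rewrite y0L; lia.
move=> lek; have eqk : k = #|R|.+1 by lia.
case: (boolP [exists y in L, [forall x in R, e y x]]).
  case/exists_inP => y yL /forall_inP ey.
  have eqR : [set x in R | e y x] = R.
    by apply/setP => x; rewrite inE; case: (boolP (x \in R)) => // /ey ->.
  exists [set y]; first by rewrite sub1set.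
  rewrite cards1 (_ : nbh e R [set y] = R) ?eqk //.
  apply/setP => x; rewrite inE; case: (boolP (x \in R)) => //= xR.
  by apply/exists_inP; exists y; rewrite ?inE ?ey.
rewrite negb_exists_in => /forall_inP nfull.
have [||y [x [yL xR neyx ltd]]] :=
    @exists_degree_lt _ _ L R (fun y x => ~~ e y x); first by lia.
  move=> y yL; have := nfull y yL; rewrite negb_forall_in => /exists_inP[x xR ?].
  by exists x.
(* Dropping [x] is harmless because [L'] keeps only its non-neighbours. By the degree inequality
   [L'] is at least as large as the set of non-neighbours of [y] in [R], which is what the bound on
   [k] asks for. *)
pose L' := [set z in L | ~~ e z x] :\ y.
pose R' := [set z in R | ~~ e y z] :\ x.
apply: (addy y L' R') => //.
- by apply: setSD; apply/subsetP => z; rewrite inE => /andP[].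
- exact: subD1set.
- move=> z x'; rewrite !inE => /and3P[_ _ nezx] x'R neyx'.
  by rewrite x'R neyx' !andbT negbK => /eqP->.
have := cardsD1 x [set z in R | ~~ e y z]; rewrite -/R' !inE xR neyx /=.
have := cardsD1 y [set z in L | ~~ e z x]; rewrite -/L' !inE yL neyx /=.
by have := cardR y; lia.
Qed.

Lemma bigcap_closed (T : finType) (J : {set {set T}}) (I : finType)
    (A : I -> {set T}) (P : {set I}) :
  setT \in J -> (forall B C, B \in J -> C \in J -> B :&: C \in J) ->
  (forall i, i \in P -> A i \in J) -> \bigcap_(i in P) A i \in J.
Proof. by move=> JT JI JA; apply: (big_ind (fun B => B \in J)). Qed.

(** Take a minimal [S] whose only superset in [J] is [setT]. If it is too large, minimality gives
    each [s] in [S] a witness [A s] in [J] that contains [S :\ s] but not [s]. Some of these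
    witnesses then intersect in exactly [t] points, which is forbidden. *)
Lemma exists_spanning_set (T : finType) (J : {set {set T}}) (t : nat) :
  t < #|T| -> setT \in J ->
  (forall A B, A \in J -> B \in J -> A :&: B \in J) ->
  (forall A, A \in J -> #|A| != t) ->
  exists2 S : {set T}, #|S| = maxn t (#|T| - t).-1 &
    forall A, A \in J -> S \subset A -> A = setT.
Proof.
move=> ltT JT JI Jt.
pose sp (S : {set T}) := [forall A in J, (S \subset A) ==> (A == setT)].
have spP (S : {set T}) : reflect (forall A, A \in J -> S \subset A -> A = setT) (sp S).
  apply: (iffP forall_inP) => [h A AJ sA|h A AJ].
    by have /implyP/(_ sA)/eqP := h A AJ.
  by apply/implyP=> sA; apply/eqP; apply: h.
have spT : sp setT by apply/spP => A _; rewrite subTset => /eqP.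
case: (arg_minnP (P := sp) (fun S : {set T} => #|S|) spT) => S spS minS.
have cT : #|S| + #|~: S| = #|T| by rewrite cardsC.
have [leS|gtS] := leqP #|S| (maxn t (#|T| - t).-1).
  have [A sSA cA] : exists2 A : {set T}, S \subset A &
      #|A| = maxn t (#|T| - t).-1.
    have [|B sB cB] := @exists_subset_card _ (~: S) (maxn t (#|T| - t).-1 - #|S|).
      by lia.
    exists (S :|: B); first exact: subsetUl.
    have SB0 : S :&: B = set0.
      by apply/eqP; rewrite setI_eq0 disjoint_sym disjoints_subset.
    by rewrite cardsU SB0 cards0 cB; lia.
  exists A => // B BJ sAB; apply: ((spP _ spS) B BJ).
  exact: subset_trans sSA sAB.
have priv s : s \in S -> exists A, [/\ A \in J, S :\ s \subset A & s \notin A].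
  move=> sS; have : ~~ sp (S :\ s).
    by apply/negP => /minS; have := cardsD1 s S; rewrite sS; lia.
  rewrite negb_forall_in => /exists_inP[A AJ].
  rewrite negb_imply => /andP[sA nT]; exists A; split=> //.
  apply: contra nT => sAs; apply/eqP; apply: (spP _ spS A AJ).
  by rewrite -(setD1K sS) subUset sub1set sAs sA.
pose A s := odflt setT [pick A in J | (S :\ s \subset A) && (s \notin A)].
have AP s : s \in S -> [/\ A s \in J, S :\ s \subset A s & s \notin A s].
  move=> sS; rewrite /A; case: pickP => [B /and3P[]//|].
  by have [B [BJ sB nB]] := priv s sS => /(_ B); rewrite inE BJ sB nB.
(* The bounds required here, [#|~: S| < #|T| - t <= #|S|], are exactly what
   [#|S| > maxn t (#|T| - t).-1] provides. *)
have [|I sIS cI] :=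
    @exists_card_nbh _ _ (fun s x => x \notin A s) S (~: S) (#|T| - t).
  by lia.
have AJ : \bigcap_(s in I) A s \in J.
  apply: bigcap_closed => // s sI; by have [] := AP s (subsetP sIS s sI).
have /negP[] := Jt _ AJ.
(* Inside [S] the witness [A s] misses only [s], so the intersection loses exactly [I] there. *)
have : ~: (\bigcap_(s in I) A s) =
    I :|: nbh (fun s x => x \notin A s) (~: S) I.
  apply/setP=> x; rewrite !inE; apply/idP/idP.
    move=> /bigcapP xA; case: (boolP (x \in I)) => //= nxI.
    have /exists_inP[s sI nxs] : [exists s in I, x \notin A s].
      apply: contra_notT xA; rewrite negb_exists_in => /forall_inP h s sI.
      by have := h s sI; rewrite negbK.
    apply/andP; split; last by apply/exists_inP; exists s.
    have [_ sA _] := AP s (subsetP sIS s sI); apply: contra nxs => xS.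
    apply: (subsetP sA); rewrite !inE xS andbT.
    by apply: contraNneq nxI => ->.
  case/orP=> [xI|/andP[_ /exists_inP[s sI nxs]]].
    have [_ _ nxx] := AP x (subsetP sIS x xI).
    by apply: contra nxx => /bigcapP; apply.
  by apply: contra nxs => /bigcapP; apply.
move=> /(congr1 (fun B : {set T} => #|B|)); rewrite cardsU (_ : _ :&: _ = set0).
  by have := cardsC (\bigcap_(s in I) A s); rewrite cards0 => *; lia.
apply/setP=> x; rewrite !inE; apply/negbTE/negP => /andP[xI /andP[nxS _]].
by rewrite (subsetP sIS x xI) in nxS.
Qed.

(** * Kernels in families of ordered edges *)

Definition link (I V : finType) (F : {set {ffun I -> V}}) (S : {set I})
    (p : {ffun I -> V}) : {set {ffun I -> V}} :=
  [set q in F | [forall i in S, q i == p i]].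

Lemma linkP (I V : finType) (F : {set {ffun I -> V}}) (S : {set I})
    (p q : {ffun I -> V}) :
  reflect (q \in F /\ {in S, q =1 p}) (q \in link F S p).
Proof.
rewrite inE; apply: (iffP andP) => -[qF h]; split=> //.
  by move=> i iS; apply/eqP; move/forall_inP: h; apply.
by apply/forall_inP => i iS; rewrite h.
Qed.

(* Asking for a large covering number of the link, rather than for many
   disjoint petals, makes kernels closed under intersection (kernelI) with no
   loss in K. *)
Definition kernel (I V : finType) (K : nat) (F : {set {ffun I -> V}})
    (S : {set I}) (p : {ffun I -> V}) : bool :=
  [forall C : {set V}, (#|C| <= K) ==>
    [exists q in link F S p, [forall i in ~: S, q i \notin C]]].

Lemma kernelP (I V : finType) (K : nat) (F : {set {ffun I -> V}})
    (S : {set I}) (p : {ffun I -> V}) :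
  reflect (forall C : {set V}, #|C| <= K ->
             exists2 q, q \in link F S p & forall i, i \notin S -> q i \notin C)
          (kernel K F S p).
Proof.
apply: (iffP forallP) => [h C cC|h C].
  have /implyP/(_ cC)/exists_inP[q qL /forall_inP qC] := h C.
  by exists q => // i iS; apply: qC; rewrite inE.
apply/implyP => /h[q qL qC]; apply/exists_inP; exists q => //.
by apply/forall_inP => i; rewrite inE => /qC.
Qed.

Lemma kernel_sub (I V : finType) (K : nat) (F F' : {set {ffun I -> V}})
    (S : {set I}) (p p' : {ffun I -> V}) :
  link F S p \subset link F' S p' -> kernel K F S p -> kernel K F' S p'.
Proof.
move=> sL /kernelP h; apply/kernelP => C /h[q qL qC].
by exists q => //; apply: (subsetP sL).
Qed.

Lemma link_sub (I V : finType) (F F' : {set {ffun I -> V}})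
    (S : {set I}) (p : {ffun I -> V}) :
  F \subset F' -> link F S p \subset link F' S p.
Proof.
move=> sF; apply/subsetP => q /linkP[qF qp]; apply/linkP; split=> //.
exact: (subsetP sF).
Qed.

Lemma kernelT (I V : finType) (K : nat) (F : {set {ffun I -> V}})
    (p : {ffun I -> V}) : p \in F -> kernel K F setT p.
Proof.
move=> pF; apply/kernelP => C _; exists p; first by apply/linkP.
by move=> i; rewrite inE.
Qed.

Lemma kernelI (I V : finType) (K : nat) (F : {set {ffun I -> V}})
    (A B : {set I}) :
  (forall p, p \in F -> kernel K F A p) ->
  (forall p, p \in F -> kernel K F B p) ->
  forall p, p \in F -> kernel K F (A :&: B) p.
Proof.
move=> kA kB p pF; apply/kernelP => C cC.
have /kernelP/(_ C cC)[q /linkP[qF qp] qC] := kB p pF.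
have /kernelP/(_ C cC)[s /linkP[sF sq] sC] := kA q qF.
exists s.
  apply/linkP; split=> // i; rewrite inE => /andP[iA iB].
  by rewrite sq ?qp.
(* On [A :\: B] the edge [s] repeats [q], which was chosen to avoid [C] off [B]; off [A] it avoids
   [C] by its own choice. *)
move=> i; rewrite inE; case: (boolP (i \in A)) => [iA /= iB|iA _]; last exact: sC.
by rewrite sq // qC.
Qed.

(** Greedy peeling: while some [S] in [J] fails to be a kernel at some edge, the whole link moves to
    [Fs S]. Edges that reach [Fs S] later differ from that link somewhere on [S], so the pieces
    gathered in [Fs S] cannot combine into a kernel. *)
Lemma kernel_split (I V : finType) (K : nat) (J : {set {set I}})
    (F : {set {ffun I -> V}}) :
  exists (F0 : {set {ffun I -> V}}) (Fs : {set I} -> {set {ffun I -> V}}),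
  [/\ F0 \subset F, forall S, Fs S \subset F,
      #|F| <= #|F0| + \sum_(S in J) #|Fs S|,
      forall S p, S \in J -> p \in F0 -> kernel K F0 S p &
      forall S p, S \in J -> p \in Fs S -> ~~ kernel K (Fs S) S p].
Proof.
have [m] := ubnP #|F|; elim: m => // m IHm in F *; rewrite ltnS => leF.
case: (boolP [exists S in J, exists p in F, ~~ kernel K F S p]); last first.
  rewrite negb_exists_in => /forall_inP h.
  exists F, (fun => set0); split=> // [S|||S p _]; rewrite ?sub0set ?leq_addr ?inE //.
  move=> S p SJ pF; have := h S SJ; rewrite negb_exists_in => /forall_inP/(_ p pF).
  by rewrite negbK.
case/exists_inP=> S0 S0J /exists_inP[p0 p0F nk].
pose Q := link F S0 p0.
have sQ : Q \subset F by apply/subsetP => q /linkP[].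
have p0Q : p0 \in Q by apply/linkP.
have cF : #|F| = #|F :\: Q| + #|Q| by rewrite -(cardsID Q F) (setIidPr sQ) addnC.
have [|F0 [Fs [sF0 sFs leFs kF0 nkFs]]] := IHm (F :\: Q).
  have Q0 : 0 < #|Q| by apply/card_gt0P; exists p0.
  by lia.
exists F0, (fun S => if S == S0 then Fs S :|: Q else Fs S); split=> //.
- exact: subset_trans sF0 (subsetDl _ _).
- move=> S; have sS := subset_trans (sFs S) (subsetDl _ _).
  by case: ifP => // _; rewrite subUset sS.
- rewrite cF (bigD1 S0) //= eqxx; move: leFs; rewrite (bigD1 S0) //= => leFs.
  rewrite [X in _ + (_ + X)](eq_bigr (fun S => #|Fs S|)); last first.
    by move=> S /andP[_ /negbTE->].
  have : #|Fs S0 :|: Q| = #|Fs S0| + #|Q|.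
    rewrite cardsU (_ : _ :&: _ = set0) ?cards0 ?subn0 //.
    apply/setP => q; rewrite !inE; apply/negbTE/negP => /andP[/(subsetP (sFs S0))].
    by rewrite inE => /andP[/negP nq _] qQ; apply: nq; rewrite /Q inE.
  by move=> ->; rewrite (addnAC #|Fs S0|) addnA leq_add2r.
move=> S p SJ; case: eqP => [->|_]; last exact: nkFs.
have sU : Fs S0 :|: Q \subset F.
  by rewrite subUset sQ (subset_trans (sFs S0)) ?subsetDl.
rewrite in_setU; case/orP => [pF|/linkP[_ pp0]].
  have /setDP[pinF pQ] := subsetP (sFs S0) p pF.
  apply: contra (nkFs _ _ S0J pF); apply: kernel_sub.
  apply/subsetP => q /linkP[]; rewrite in_setU; case/orP => [qF qp|/linkP[_ qp0] qp].
    exact/linkP.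
  case/negP: pQ; apply/linkP; split=> // i iS; by rewrite -qp // qp0.
apply: contra nk; apply: kernel_sub; apply/subsetP => q /linkP[qU qp].
by apply/linkP; split=> [|i iS]; [apply: (subsetP sU) | rewrite qp ?pp0].
Qed.

Lemma leq_card_bigcup (T U : finType) (P : {set T}) (A : T -> {set U}) (m : nat) :
  (forall i, i \in P -> #|A i| <= m) -> #|\bigcup_(i in P) A i| <= #|P| * m.
Proof.
move=> le; rewrite -sum_nat_const.
apply: (@leq_trans (\sum_(i in P) #|A i|)); last exact: leq_sum.
elim/big_rec2: _ => [|i a B _ leB]; first by rewrite cards0.
by rewrite (leq_trans (leq_card_setU _ _)) // leq_add2l.
Qed.

(** Induction on the number of free positions: a set [C] of at most [K] vertices meets every edge of
    the link off [S]. Fixing a position and a vertex of [C] there leaves at most [#|I| * K] choices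
    and enlarges [S] by one. *)
Lemma card_link_nonkernel (I V : finType) (K : nat) (F : {set {ffun I -> V}})
    (S : {set I}) (p : {ffun I -> V}) :
  (forall (A : {set I}) q, S \subset A -> A != setT -> q \in F -> ~~ kernel K F A q) ->
  #|link F S p| <= (#|I| * K) ^ (#|I| - #|S|).
Proof.
have [m] := ubnP (#|I| - #|S|); elim: m => // m IHm in S p *; rewrite ltnS => leS nk.
have [->|ST] := eqVneq S setT.
  rewrite cardsT subnn expn0 -(cards1 p) subset_leq_card //.
  apply/subsetP => q /linkP[_ qp]; rewrite inE; apply/eqP/ffunP => i.
  by rewrite qp.
have ltS : #|S| < #|I| by rewrite -cardsT proper_card // properT.
(* [p] may lie outside [F], where nothing is known about kernels; any member [p'] of the link
   defines the same link. *)
have [->|[p' /linkP[p'F p'p]]] := set_0Vmem (link F S p); first by rewrite cards0.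
have := nk S p' (subxx _) ST p'F; rewrite negb_forall => /existsP[C].
rewrite negb_imply => /andP[cC]; rewrite negb_exists_in => /forall_inP cover.
pose upd i c := [ffun j => if j == i then c else p j].
have sub : link F S p \subset
    \bigcup_(i in ~: S) \bigcup_(c in C) link F (i |: S) (upd i c).
  apply/subsetP => q /linkP[qF qp].
  have : q \in link F S p' by apply/linkP; split=> // i iS; rewrite qp ?p'p.
  move=> /cover; rewrite negb_forall_in => /exists_inP[i iS]; rewrite negbK => qC.
  apply/bigcupP; exists i => //; apply/bigcupP; exists (q i) => //.
  apply/linkP; split=> // j; rewrite in_setU1 ffunE; case: eqP => [->|_] //=.
  exact: qp.
apply: leq_trans (subset_leq_card sub) _.
have -> : #|I| - #|S| = (#|I| - #|S|.+1).+1 by lia.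
rewrite expnS -mulnA.
apply: leq_trans (leq_card_bigcup (m := K * (#|I| * K) ^ (#|I| - #|S|.+1)) _) _.
  move=> i; rewrite inE => iS.
  apply: leq_trans (leq_card_bigcup (m := (#|I| * K) ^ (#|I| - #|S|.+1)) _) _.
    move=> c _; have cS : #|i |: S| = #|S|.+1 by rewrite cardsU1 iS.
    rewrite -cS; apply: IHm; first by rewrite cS; lia.
    move=> A q sA; apply: nk; apply: subset_trans sA; exact: subsetUr.
  by rewrite leq_mul2r cC orbT.
by rewrite leq_mul2r max_card orbT.
Qed.

Lemma card_family_link (I V : finType) (F : {set {ffun I -> V}}) (S : {set I})
    (m : nat) :
  (forall p, #|link F S p| <= m) -> #|F| <= #|V| ^ #|S| * m.
Proof.
move=> le; have [->|[p0 p0F]] := set_0Vmem F; first by rewrite cards0.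
(* Traces on [S] are counted as functions with constant value [v0] off [S]; finding [v0] takes a
   position, hence the separate empty case. *)
have [S0|[i0 _]] := set_0Vmem S.
  rewrite S0 cards0 mul1n; apply: leq_trans (le p0); apply: subset_leq_card.
  by apply/subsetP => q qF; apply/linkP; split=> // i; rewrite S0 inE.
pose v0 := p0 i0; rewrite -(card_pffun_on v0 (mem S) (@predT V)).
set P := pffun_on _ _ _; rewrite -(cardsE P).
apply: leq_trans (leq_card_bigcup (fun p _ => le p)); apply: subset_leq_card.
apply/subsetP => q qF; apply/bigcupP.
exists [ffun i => if i \in S then q i else v0].
  rewrite inE; apply/pffun_onP; split=> //.
  by apply/supportP => i iS; rewrite ffunE (negbTE iS).
by apply/linkP; split=> // i iS; rewrite ffunE iS.
Qed.

(** Induction on [J], a set of candidates that contains every kernel. On [F0] the kernels are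
    exactly the members of [J], and a spanning set gives the bound; on each [Fs S] the candidate [S]
    is eliminated. There are at most [2 ^ #|I|] such pieces besides [F0], hence the factor per
    round. *)
Lemma card_nonkernel_family (I V : finType) (K t : nat) (J : {set {set I}})
    (F : {set {ffun I -> V}}) :
  let M := maxn t (#|I| - t).-1 in
  t < #|I| ->
  (forall (S : {set I}) p, #|S| = t -> p \in F -> ~~ kernel K F S p) ->
  (forall S p, S \notin J -> p \in F -> ~~ kernel K F S p) ->
  #|F| <= (2 ^ #|I|).+1 ^ #|J| * (#|V| ^ M * (#|I| * K) ^ (#|I| - M)).
Proof.
move=> M ltI; set B := #|V| ^ M * _.
have [m] := ubnP #|J|; elim: m => // m IHm in J F *; rewrite ltnS => leJ nkt nkJ.
have [F0 [Fs [sF0 sFs leF kF0 nkFs]]] := kernel_split K J F.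
have leF0 : #|F0| <= B.
  have [->|[p pF0]] := set_0Vmem F0; first by rewrite cards0.
  have pF := subsetP sF0 p pF0.
  have JI (S : {set I}) : (forall q, q \in F0 -> kernel K F0 S q) -> S \in J.
    move=> kS; apply: contraT => /nkJ/(_ pF)/negP[].
    by apply: kernel_sub (kS p pF0); apply: link_sub.
  have [|||S cS maxS] := @exists_spanning_set _ J t ltI.
  - by apply: JI => q; apply: kernelT.
  - move=> A C AJ CJ; apply: JI; apply: kernelI => q qF0; exact: kF0.
  - move=> A AJ; apply/eqP => At; have /negP[] := nkt A p At pF.
    apply: kernel_sub (kF0 A p AJ pF0); exact: link_sub.
  rewrite /B /M -cS; apply: card_family_link => q; apply: card_link_nonkernel.
  move=> A s sSA AT sF; have AJ : A \notin J.
    by apply: contra AT => AJ; apply/eqP; apply: maxS.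
  apply: contra (nkJ A s AJ (subsetP sF0 s sF)); apply: kernel_sub; exact: link_sub.
have [J0|[S0 S0J]] := set_0Vmem J.
  by move: leF; rewrite J0 big_set0 addn0 cards0 mul1n => /leq_trans; apply.
have J1 S : S \in J -> #|J| = #|J :\ S|.+1 by move=> SJ; rewrite (cardsD1 S) SJ.
have leFs S : S \in J -> #|Fs S| <= (2 ^ #|I|).+1 ^ #|J|.-1 * B.
  move=> SJ; rewrite (J1 S SJ) /=; apply: IHm; first by have := J1 S SJ; lia.
    move=> A p At pF; apply: contra (nkt A p At (subsetP (sFs S) p pF)).
    by apply: kernel_sub; apply: link_sub.
  move=> A p; rewrite !inE negb_and negbK => /orP[/eqP-> pF|AJ pF].
    exact: nkFs.
  apply: contra (nkJ A p AJ (subsetP (sFs S) p pF)).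
  by apply: kernel_sub; apply: link_sub.
set X := _ * B in leFs.
apply: leq_trans leF _; apply: (@leq_trans (B + \sum_(S in J) X)).
  by rewrite leq_add // leq_sum.
rewrite sum_nat_const (_ : _ ^ #|J| * B = (2 ^ #|I|).+1 * X); last first.
  by rewrite /X (J1 S0 S0J) expnS -mulnA.
 have leBX : B <= X by rewrite leq_pmull ?expn_gt0.
rewrite mulSn leq_add // leq_mul2r; apply/orP; right.
by apply: leq_trans (max_card _) _; rewrite -cardsT -powersetT card_powerset cardsT.
Qed.

(** * Sunflowers *)

Lemma contains_copy_sunflower (T U : finType) (r t k : nat)
    (H : {set {set T}}) (G : {set {set U}}) :
  0 < k -> is_sunflower r t k H -> contains_copy H G ->
  exists (B : 'I_k -> {set U}) (D : {set U}),
    [/\ forall i, B i \in G, #|D| = t, forall i, D \subset B i &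
        forall i j, i != j -> [disjoint B i :\: D & B j :\: D]].
Proof.
move=> k0 [A [-> injA cA [C [cC sC dA]]]] /existsP[f /andP[/forall_inP finj fG]].
move/forall_inP: fG => fG.
have covA i x : x \in A i -> x \in cover [set A i | i : 'I_k].
  by move=> xA; apply/bigcupP; exists (A i); rewrite ?imset_f.
have f_inj i j x y : x \in A i -> y \in A j -> f x = f y -> x = y.
  move=> xA yA fxy; have /forall_inP/(_ y (covA _ _ yA)) := finj x (covA _ _ xA).
  by rewrite fxy eqxx => /eqP.
exists (fun i => f @: A i), (f @: C); split=> [i||i|i j neq].
- by apply: fG; rewrite imset_f.
(* [f] is known to be injective only on covered vertices; as [0 < k], some edge contains [C]. *)
- rewrite card_in_imset // => x y xC yC; pose i := Ordinal k0.
  by apply: (f_inj i i); apply: (subsetP (sC i)).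
- exact: imsetS.
apply/pred0P => u /=; apply/negbTE/negP; rewrite !in_setD.
case/andP=> /andP[uC /imsetP[x xA eqx]] /andP[_ /imsetP[y yA eqy]].
have eqxy : x = y by apply: (f_inj i j); rewrite // -eqx.
have xC : x \notin C by apply: contra uC => xC; rewrite eqx imset_f.
have /pred0P/(_ x) := dA i j neq.
by rewrite /= !inE xC xA eqxy yA.
Qed.

(** For sets of equal size, this is the bijection matching their enumerations; points outside [X] go
    to the default [u0]. *)
Definition transfer (T U : finType) (u0 : U) (X : {set T}) (Y : {set U}) (x : T) : U :=
  nth u0 (enum Y) (index x (enum X)).

Lemma transfer_in (T U : finType) (u0 : U) (X : {set T}) (Y : {set U}) (x : T) :
  #|X| = #|Y| -> x \in X -> transfer u0 X Y x \in Y.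
Proof.
move=> cXY xX; rewrite -mem_enum mem_nth // -cardE -cXY cardE index_mem.
by rewrite mem_enum.
Qed.

Lemma transfer_inj (T U : finType) (u0 : U) (X : {set T}) (Y : {set U}) :
  #|X| = #|Y| -> {in X &, injective (transfer u0 X Y)}.
Proof.
move=> cXY x y xX yX /eqP; have lt z : z \in X -> index z (enum X) < size (enum Y).
  by move=> zX; rewrite -cardE -cXY cardE index_mem mem_enum.
rewrite nth_uniq ?enum_uniq ?lt // => /eqP eqi.
by rewrite -(@nth_index _ x x (enum X)) ?mem_enum // eqi nth_index ?mem_enum.
Qed.

(** The embedding glues bijections from [C] to [D] and from each [A i :\: C] to [B i :\: D].
    Disjointness of the petals in [H] makes it well defined, disjointness of those in [G] makes it
    injective. *)
Lemma sunflower_contains_copy (T U : finType) (r t k : nat)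
    (H : {set {set T}}) (G : {set {set U}})
    (B : 'I_k -> {set U}) (D : {set U}) :
  0 < r -> 0 < k -> is_sunflower r t k H ->
  (forall i, #|B i| = r) -> (forall i, B i \in G) -> #|D| = t ->
  (forall i, D \subset B i) ->
  (forall i j, i != j -> [disjoint B i :\: D & B j :\: D]) ->
  contains_copy H G.
Proof.
move=> r0 k0 [A [-> injA cA [C [cC sC dA]]]] cB BG cD sD dB.
have [u0 _] : exists u, u \in B (Ordinal k0) by apply/card_gt0P; rewrite cB.
pose f x := if x \in C then transfer u0 C D x else
  if [pick i | x \in A i] is Some i then transfer u0 (A i :\: C) (B i :\: D) x
  else u0.
have cCD : #|C| = #|D| by rewrite cC cD.
have cAB i : #|A i :\: C| = #|B i :\: D|.
  by rewrite !cardsD !(setIidPr _) // cA cB cC cD.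
have fC x : x \in C -> f x = transfer u0 C D x by rewrite /f => ->.
have fA i x : x \in A i -> x \notin C ->
    f x = transfer u0 (A i :\: C) (B i :\: D) x.
  move=> xA xC; rewrite /f (negbTE xC); case: pickP => [j xj|/(_ i)]; last by rewrite xA.
  have [->//|neq] := eqVneq j i; have /pred0P/(_ x) := dA j i neq.
  by rewrite /= !inE xC xA xj.
have fCD x : x \in C -> f x \in D by move=> xC; rewrite fC // transfer_in.
have fAB i x : x \in A i -> x \notin C -> f x \in B i :\: D.
  by move=> xA xC; rewrite (fA i) // transfer_in // in_setD xC.
have f_inj i j x y : x \in A i -> y \in A j -> f x = f y -> x = y.
  move=> xA yA eqf; case: (boolP (x \in C)) => xC; case: (boolP (y \in C)) => yC.
  - by apply: (transfer_inj cCD (u0 := u0)) => //; rewrite -!fC.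
  - by have := fAB j y yA yC; rewrite -eqf in_setD fCD.
  - by have := fAB i x xA xC; rewrite eqf in_setD fCD.
  have [eqij|neq] := eqVneq i j; last first.
    have /pred0P/(_ (f x)) := dB i j neq; rewrite /= {2}eqf.
    by rewrite (fAB i x xA xC) (fAB j y yA yC).
  rewrite -eqij in yA; apply: (transfer_inj (cAB i) (u0 := u0)).
  - by rewrite in_setD xC.
  - by rewrite in_setD yC.
  by rewrite -!fA.
apply/existsP; exists [ffun x => f x]; apply/andP; split.
  apply/forall_inP => x /bigcupP[_ /imsetP[i _ ->] xA].
  apply/forall_inP => y /bigcupP[_ /imsetP[j _ ->] yA].
  by apply/implyP; rewrite !ffunE => /eqP/(f_inj _ _ _ _ xA yA) ->.
apply/forall_inP => _ /imsetP[i _ ->].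
rewrite (_ : _ @: _ = B i) //; apply/eqP; rewrite eqEcard; apply/andP; split.
  apply/subsetP => _ /imsetP[x xA ->]; rewrite ffunE.
  case: (boolP (x \in C)) => xC; first by apply: (subsetP (sD i)); apply: fCD.
  by have := fAB i x xA xC; rewrite in_setD => /andP[].
rewrite card_in_imset ?cA ?cB // => x y xA yA; rewrite !ffunE; exact: (f_inj i i).
Qed.

(** Edges are picked greedily, each avoiding off [S] all vertices used off [S] by the earlier ones.
    Fewer than [k] edges use at most [#|I| * k] such vertices, so [K] allows one more choice. *)
Lemma kernel_sunflower (I V : finType) (K k : nat) (F : {set {ffun I -> V}})
    (S : {set I}) (p : {ffun I -> V}) :
  (forall q, q \in F -> injective q) -> p \in F -> #|I| * k <= K ->
  kernel K F S p ->
  exists (B : 'I_k -> {set V}) (D : {set V}),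
    [/\ forall i, exists2 q, q \in F & B i = q @: setT,
        #|D| = #|S|, forall i, D \subset B i &
        forall i j, i != j -> [disjoint B i :\: D & B j :\: D]].
Proof.
move=> Finj pF leK /kernelP kS.
have [s [sz sL sd]] : exists s : seq {ffun I -> V}, [/\ size s = k,
    {subset s <= link F S p} &
    pairwise (fun q q' : {ffun I -> V} => [disjoint q @: ~: S & q' @: ~: S]) s].
  elim: k leK => [|k IHk] leK; first by exists [::].
  have [|s [sz sL sd]] := IHk; first by lia.
  pose C := \bigcup_(q in [set q in s]) q @: ~: S.
  have [|q qL qC] := kS C.
    apply: leq_trans (leq_card_bigcup (m := #|I|) _) _.
      by move=> q _; apply: leq_trans (leq_imset_card _ _) (max_card _).
    apply: leq_trans leK; rewrite mulnC leq_mul2l cardsE.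
    by rewrite (leq_trans (card_size s)) ?sz ?leqnSn ?orbT.
  exists (q :: s); split=> /=; first by rewrite sz.
    by move=> x; rewrite inE => /orP[/eqP->|/sL].
  rewrite sd andbT; apply/allP => x xs; apply/pred0P => u /=.
  apply/negbTE/negP => /andP[/imsetP[i]]; rewrite inE => iS -> qx.
  have /negP[] := qC i iS; apply/bigcupP; exists x => //.
  by rewrite inE.
pose q i := nth p s i.
have qL (i : 'I_k) : q i \in link F S p by apply: sL; rewrite mem_nth ?sz.
have pet (i : 'I_k) : (q i @: setT) :\: (p @: S) \subset q i @: ~: S.
  apply/subsetP => u /setDP[/imsetP[x _ ->] nx]; apply: imset_f.
  rewrite inE; apply: contra nx => xS; have /linkP[_ ->] // := qL i.
  exact: imset_f.
have dis (i j : 'I_k) : i < j -> [disjoint q i @: setT :\: p @: S & q j @: setT :\: p @: S].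
  move=> ltij; apply: disjointWl (pet i) _; apply: disjointWr (pet j) _.
  by move/(pairwiseP p): sd => /(_ i j); apply; rewrite // inE sz.
exists (fun i => q i @: setT), (p @: S); split=> [i||i|i j neq].
- by exists (q i) => //; have /linkP[] := qL i.
- by rewrite card_imset //; apply: Finj.
- apply/subsetP => _ /imsetP[x xS ->]; have /linkP[_ <-] // := qL i.
  exact: imset_f.
case: (ltngtP i j) => [/dis//|/dis|/val_inj eqij]; first by rewrite disjoint_sym.
by rewrite eqij eqxx in neq.
Qed.

(** Each edge is ordered once, by its enumeration, so no edges are gained or lost. With [K = r * k]
    a kernel of size [t] would give the sunflower, and all [2 ^ r] sets of positions serve as
    initial candidates. *)
Lemma card_sunflower_free (T V : finType) (r t k : nat) (H : {set {set T}})
    (G : {set {set V}}) :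
  let M := maxn t (r - t).-1 in
  t < r -> 0 < k -> is_sunflower r t k H -> uniform r G -> ~~ contains_copy H G ->
  #|G| <= (2 ^ r).+1 ^ (2 ^ r) * (#|V| ^ M * (r * (r * k)) ^ (r - M)).
Proof.
move=> M ltr k0 sunH /forall_inP uG free.
have cG e : e \in G -> #|e| = r by move/uG/eqP.
have [->|[e0 e0G]] := set_0Vmem G; first by rewrite cards0.
have [v0 _] : exists v, v \in e0 by apply/card_gt0P; rewrite (cG _ e0G); lia.
pose ord (e : {set V}) : {ffun 'I_r -> V} := [ffun i : 'I_r => nth v0 (enum e) i].
have ordT e : e \in G -> ord e @: setT = e.
  move=> eG; apply/setP => v; apply/imsetP/idP => [[i _ ->]|ve].
    by rewrite ffunE -mem_enum mem_nth // -cardE cG.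
  have lt : index v (enum e) < r by rewrite -(cG _ eG) cardE index_mem mem_enum.
  by exists (Ordinal lt); rewrite // ffunE nth_index ?mem_enum.
have ord_inj e : e \in G -> injective (ord e).
  move=> eG i j; rewrite !ffunE => /eqP.
  by rewrite nth_uniq ?enum_uniq -?cardE ?cG // => /eqP/val_inj.
pose F := ord @: G.
have FP q : q \in F -> injective q /\ q @: setT \in G.
  by case/imsetP => e eG ->; rewrite ordT //; split=> //; apply: ord_inj.
have <- : #|F| = #|G|.
  by rewrite card_in_imset // => e e' eG e'G eqo; rewrite -(ordT e) // eqo ordT.
have := @card_nonkernel_family _ _ (r * k) t setT F.
have -> : #|[set: {set 'I_r}]| = 2 ^ r.
  by rewrite -powersetT card_powerset cardsT card_ord.
rewrite card_ord; apply; first exact: ltr; last by move=> S p; rewrite inE.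
move=> S p cS pF.
apply: contra free => kS.
have [|||B [D [BG cD sD dB]]] := @kernel_sunflower _ _ (r * k) k F S p _ _ _ kS.
- by move=> q /FP[].
- exact: pF.
- by rewrite card_ord.
have {}BG i : B i \in G by have [q /FP[_ qG] ->] := BG i.
apply: (sunflower_contains_copy (B := B) (D := D)) sunH _ _ _ _ _ => //.
- by lia.
- by move=> i; apply: cG.
- by rewrite cD.
Qed.

(** * Lower bounds *)

Lemma leq_turan (T : finType) (r n : nat) (H : {set {set T}})
    (G : {set {set 'I_n}}) :
  uniform r G -> ~~ contains_copy H G -> #|G| <= turan r n H.
Proof.
by move=> uG free; apply: leq_bigmax_cond; rewrite uG.
Qed.

Lemma leq_card_transversal (U : finType) (k : nat) (P : 'I_k -> {set U})
    (S : {set U}) :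
  (forall i, exists u, u \in P i :&: S) ->
  (forall i j, i != j -> [disjoint P i & P j]) -> k <= #|S|.
Proof.
move=> PS dP; pose f i := xchoose (PS i).
have fP i : f i \in P i :&: S by apply: xchooseP.
rewrite -[k in k <= _]card_ord -cardsT -(@card_imset _ _ f) => [|i j eqf].
  apply: subset_leq_card; apply/subsetP => _ /imsetP[i _ ->].
  by have := fP i; rewrite in_setI => /andP[].
apply/eqP; apply: contraT => neq; have /pred0P/(_ (f i)) := dP i j neq.
have := fP i; have := fP j; rewrite -eqf !in_setI /= => /andP[-> _] /andP[-> _].
by [].
Qed.

(** * Counting supersets and estimating binomial coefficients *)

Lemma card_supersets (T : finType) (A : {set T}) (r : nat) :
  #|A| <= r ->
  #|[set e : {set T} | A \subset e & #|e| == r]| = 'C(#|T| - #|A|, r - #|A|).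
Proof.
move=> leA; rewrite -[#|T| - _](_ : #|~: A| = _); last by rewrite cardsCs setCK.
rewrite -cards_draws -[RHS](@card_in_imset _ _ (fun B => A :|: B)) => [|B C]; last first.
  rewrite !inE => /andP[sB _] /andP[sC _] /(congr1 (fun D => D :\: A)).
  rewrite !setDUl setDv !set0U !setDE.
  by rewrite (setIidPl sB) (setIidPl sC).
congr #|pred_of_set _|; apply/setP => e; rewrite inE; apply/andP/imsetP.
  case=> sA /eqP cE; exists (e :\: A); last by rewrite -{1}(setIidPr sA) setID.
  by rewrite inE cardsD (setIidPr sA) cE eqxx andbT setDE subsetIr.
case=> B; rewrite inE => /andP[sB /eqP cB] ->; split; first exact: subsetUl.
have AB0 : A :&: B = set0.
  by apply/eqP; rewrite setI_eq0 disjoint_sym disjoints_subset.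
by rewrite cardsU AB0 cards0 cB; apply/eqP; lia.
Qed.

Lemma leq_expn_bin (m j : nat) : j <= m -> m ^ j <= j ^ j * 'C(m, j).
Proof.
elim: j m => [|j IHj] [|m] //; rewrite ltnS => lejm.
have /= := mul_bin_diag m.+1 j; rewrite expnS => eqb.
rewrite (_ : j.+1 ^ j.+1 * _ = m.+1 * (j.+1 ^ j * 'C(m, j))); last first.
  by rewrite expnS -mulnA mulnCA -eqb mulnCA.
rewrite leq_mul2l /=; case: j lejm {eqb} IHj => [|j] lejm IHj; first by rewrite bin0.
have jj : 0 < j.+1 ^ j.+1 by rewrite expn_gt0.
(* The comparison of powers comes down to [j.+1 * m.+1 <= j.+2 * m], which holds as [j.+1 <= m]. *)
rewrite -(leq_pmul2l jj) mulnCA.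
apply: (@leq_trans (j.+2 ^ j.+1 * m ^ j.+1)); last by rewrite leq_mul2l IHj ?orbT.
by rewrite -!expnMn leq_exp2r //; lia.
Qed.

Lemma leq_bin_exp2 (r j : nat) : 'C(r, j) <= 2 ^ r.
Proof.
have [le|lt] := leqP j r; last by rewrite bin_small.
rewrite (_ : 2 ^ r = (1 + 1) ^ r) // expnDn (bigD1 (Ordinal (le : j < r.+1))) //=.
by rewrite !exp1n !muln1 leq_addr.
Qed.

Lemma leq_bin_expn (m j : nat) : 'C(m, j) <= m ^ j.
Proof.
apply: (@leq_trans ('C(m, j) * j`!)); first by rewrite leq_pmulr ?fact_gt0.
rewrite bin_ffact; elim: j m => [|j IHj] m //; rewrite ffactnS expnS leq_mul2l.
apply/orP; right; apply: leq_trans (IHj _) _.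
by case: j {IHj} => // j; rewrite leq_exp2r // leq_pred.
Qed.

(** * Two sunflower-free constructions *)

Lemma turan_ge_heavy (T : finType) (r t k n : nat) (H : {set {set T}}) :
  t < r -> r <= n -> 1 < k <= n -> is_sunflower r t k H ->
  n ^ (r - t.+1) * k ^ t.+1 <= (4 * r ^ 3) ^ r * turan r n H.
Proof.
move=> ltr lern /andP[k1 lekn] sunH; pose s := maxn k.-1 t.+1.
have [S _ cS] : exists2 S : {set 'I_n}, S \subset setT & #|S| = s.
  by apply: exists_subset_card; rewrite cardsT card_ord /s; lia.
pose G := [set e : {set 'I_n} | (#|e| == r) && (t < #|e :&: S|)].
have GP e : e \in G -> #|e| = r /\ t < #|e :&: S|.
  by rewrite inE => /andP[/eqP].
have uG : uniform r G by apply/forall_inP => e /GP[->].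
have free : ~~ contains_copy H G.
  apply/negP => /(contains_copy_sunflower (ltnW k1) sunH)[B [D [BG cD sD dB]]].
  (* If [s = t.+1], every edge contains [S], and two disjoint petals force [S] into [D], which has
     only [t] points. If [s = k.-1], each petal meets [S] outside [D], so [k] disjoint petals need
     [k] points of [S]. *)
  have [les|gts] := leqP k.-1 t.+1.
    have sB i : S \subset B i.
      have [_ tB] := GP _ (BG i); apply/setIidPr/eqP.
      by rewrite eqEcard subsetIr cS /s; lia.
    pose i0 := Ordinal (ltnW k1); pose i1 := Ordinal k1.
    have /pred0P d01 := dB i0 i1 isT.
    have : S \subset D.
      apply/subsetP => u uS; apply: contraT => uD; have := d01 u.
      by rewrite /= !in_setD uD !(subsetP (sB _)).
    by move/subset_leq_card; rewrite cD cS /s; lia.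
  suff : k <= #|S| by rewrite cS /s; lia.
  apply: leq_card_transversal dB => i; apply/set0Pn; apply/negP => /eqP Bi0.
  have [_] := GP _ (BG i); rewrite ltnNge -cD => /negP[]; apply: subset_leq_card.
  apply/subsetP => u /setIP[uB uS]; apply: contraT => uD.
  by have /setP/(_ u) := Bi0; rewrite !inE uD uB uS.
(* Double counting of the pairs [A \subset e] with [A] a subset of [S] of size [t.+1] and [e] in
   [G]. *)
have count : 'C(s, t.+1) * 'C(n - t.+1, r - t.+1) <= #|G| * 'C(r, t.+1).
  pose X := [set A : {set 'I_n} | A \subset S & #|A| == t.+1].
  apply: (@leq_trans (\sum_(A in X) \sum_(e in G | A \subset e) 1)).
    rewrite -cS -cards_draws -/X -sum_nat_const; apply: leq_sum => A.
    rewrite inE => /andP[sA /eqP cA].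
    have := @card_supersets _ A r; rewrite cA card_ord => <- //.
    rewrite sum1dep_card; apply: subset_leq_card; apply/subsetP => e.
    rewrite !inE => /andP[sAe /eqP->]; rewrite eqxx sAe /= andbT -cA.
    by apply: subset_leq_card; rewrite subsetI sAe.
  rewrite (exchange_big_dep (fun e => e \in G)) /=; last by move=> ? ? _ /andP[].
  rewrite -sum_nat_const; apply: leq_sum => e /GP[ce _].
  rewrite sum1dep_card -ce -cards_draws; apply: subset_leq_card.
  apply/subsetP => A; rewrite !inE => /andP[/andP[_ cA] /andP[_ sAe]].
  by rewrite sAe.
have leG := leq_turan uG free.
have r0 : 0 < r by lia.
have lek : k ^ t.+1 <= 2 ^ r * r ^ r * 'C(s, t.+1).
  apply: (@leq_trans ((2 * s) ^ t.+1)); first by rewrite leq_exp2r // /s; lia.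
  rewrite expnMn -mulnA leq_mul ?leq_exp2l //.
  apply: leq_trans (leq_expn_bin _) _; first by rewrite /s; lia.
  rewrite leq_mul2r; apply/orP; right.
  by apply: (@leq_trans (r ^ t.+1)); rewrite ?leq_exp2r // leq_pexp2l.
have len : n ^ (r - t.+1) <= r ^ r * r ^ r * 'C(n - t.+1, r - t.+1).
  (* If [r = t.+1], then [n - t.+1] may vanish; otherwise [t + 2 <= r <= n] yields
     [n <= r * (n - t.+1)]. *)
  have [->|neq] := eqVneq (r - t.+1) 0.
    by rewrite bin0 muln1 muln_gt0 expn_gt0 r0.
  apply: (@leq_trans ((r * (n - t.+1)) ^ (r - t.+1))).
    rewrite leq_exp2r; first by nia.
    by lia.
  rewrite expnMn -mulnA leq_mul //; first by rewrite leq_pexp2l //; lia.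
  apply: leq_trans (leq_expn_bin _) _; first by lia.
  rewrite leq_mul2r; apply/orP; right.
  apply: (@leq_trans (r ^ (r - t.+1))).
    by rewrite leq_exp2r; lia.
  by rewrite leq_pexp2l //; lia.
apply: leq_trans (leq_mul len lek) _.
set a := 'C(_, _) in count *; set b := 'C(_, _) in count *.
rewrite (_ : _ * _ = 2 ^ r * (r ^ r) ^ 3 * (a * b)); last by rewrite !expnS; ring.
apply: leq_trans (leq_mul (leqnn _) count) _.
(* Two factors [r ^ r] come from [len], the third and one [2 ^ r] from [lek], and the last [2 ^ r]
   bounds ['C(r, t.+1)]. *)
rewrite (_ : (4 * r ^ 3) ^ r = 2 ^ r * (r ^ r) ^ 3 * 2 ^ r); last first.
  by rewrite -expnM (mulnC r 3) expnM mulnAC -expnMn -expnMn.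
rewrite -[X in _ <= X]mulnA leq_mul2l; apply/orP; right.
by rewrite mulnC leq_mul // leq_bin_exp2.
Qed.

(** Take [P] maximal: every [r]-set then shares a [t]-set with some member, or it could be added.
    Counting the [t]-subsets of members and the [r]-sets above each of them gives the bound. *)
Lemma exists_packing (V : finType) (r t : nat) :
  t <= r -> exists P : {set {set V}},
  [/\ forall e, e \in P -> #|e| = r,
      forall e f : {set V}, e \in P -> f \in P -> t <= #|e :&: f| -> e = f &
      'C(#|V|, r) <= #|P| * ('C(r, t) * 'C(#|V| - t, r - t))].
Proof.
move=> letr; pose pk (P : {set {set V}}) := uniform r P &&
  [forall e in P, forall f in P, (t <= #|e :&: f|) ==> (e == f)].
have pkP (P : {set {set V}}) : reflect ((forall e, e \in P -> #|e| = r) /\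
    (forall e f : {set V}, e \in P -> f \in P -> t <= #|e :&: f| -> e = f)) (pk P).
  apply: (iffP andP) => [[/forall_inP u /forall_inP h]|[u h]]; split.
  - by move=> e /u/eqP.
  - by move=> e f eP fP le; have /forall_inP/(_ f fP) := h e eP; rewrite le => /eqP.
  - by apply/forall_inP => e /u/eqP.
  apply/forall_inP => e eP; apply/forall_inP => f fP.
  by apply/implyP => le; rewrite (h e f).
have pk0 : pk set0 by apply/pkP; split=> [e|e f]; rewrite inE.
case: (arg_maxnP (P := pk) (fun P : {set {set V}} => #|P|) pk0) => P /pkP[uP hP] maxP.
exists P; split=> //; rewrite -card_draws.
have near (f : {set V}) : #|f| = r -> exists2 e, e \in P & t <= #|e :&: f|.
  move=> cf; apply/exists_inP; apply: contraT; rewrite negb_exists_in.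
  move/forall_inP => far; have fP : f \notin P.
    by apply/negP => /far; rewrite setIid cf letr.
  have /maxP : pk (f |: P); last by rewrite cardsU1 fP; lia.
  apply/pkP; split=> [e|e g]; rewrite !in_setU1.
    by case/orP => [/eqP->|/uP].
  case/orP=> [/eqP->|eP] /orP[/eqP->|gP] // le; last exact: hP.
    by have /negP[] := far g gP; rewrite setIC.
  by have /negP[] := far e eP.
apply: (@leq_trans #|\bigcup_(e in P)
    \bigcup_(A in [set A : {set V} | A \subset e & #|A| == t])
      [set f : {set V} | A \subset f & #|f| == r]|).
  apply: subset_leq_card; apply/subsetP => f; rewrite inE => /eqP cf.
  have [e eP le] := near f cf; have [A sA cA] := exists_subset_card le.
  have /andP[sAe sAf] : (A \subset e) && (A \subset f) by rewrite -subsetI.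
  apply/bigcupP; exists e => //; apply/bigcupP; exists A; rewrite inE.
    by rewrite sAe cA eqxx.
  by rewrite sAf cf eqxx.
apply: leq_card_bigcup => e eP; rewrite -(uP e eP) -cards_draws (uP e eP).
apply: leq_card_bigcup => A; rewrite inE => /andP[_ /eqP cA].
by rewrite card_supersets cA.
Qed.

Lemma turan_ge_packing (T : finType) (r t k n : nat) (H : {set {set T}}) :
  t < r -> r <= n -> 1 < k <= n -> is_sunflower r t k H ->
  n ^ t * k ^ (r - t) <= (4 * r * (r + 3)) ^ r * turan r n H.
Proof.
move=> ltr lern /andP[k1 lekn] sunH.
(* The number of classes: at least [n / (k - 1)] rounded up, so that no class exceeds [k - 1]
   points, and at least [r], so that an edge fits. *)
pose m := maxn r (n.-1 %/ k.-1).+1.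
have lediv : n.-1 %/ k.-1 <= n.-1 by apply: leq_div.
have lemn : m <= n by rewrite /m; lia.
have m0 : 0 < m by rewrite /m; lia.
have ltn : n.-1 < (n.-1 %/ k.-1).+1 * k.-1 by apply: ltn_ceil; lia.
have lenmk : n <= m * k.-1.
  apply: (@leq_trans ((n.-1 %/ k.-1).+1 * k.-1)); first by lia.
  by rewrite leq_mul2r /m leq_maxr orbT.
(* If [m = r], use [k <= n]; otherwise [m = q + 1] and [m * k = q * (k - 1) + q + k <= 3 * n]. *)
have lemk : m * k <= (r + 3) * n.
  have lek : n.-1 %/ k.-1 * k.-1 <= n.-1 by apply: leq_trunc_div.
  rewrite /m; move: lek; set q := _ %/ _ => lek.
  have [le|lt] := leqP r q.+1; first by nia.
  by rewrite mulnDl; nia.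
(* Every class has at least [b.+1] points; the successor form provides the default [ord0] for the
   choice functions below. *)
have [b eqb] : exists b, n %/ m = b.+1.
  by exists (n %/ m).-1; rewrite prednK // divn_gt0.
have lemb : m * b.+1 <= n by rewrite mulnC -eqb leq_trunc_div.
have len2 : n <= 2 * m * b.+1.
  by have := ltn_ceil n m0; rewrite eqb; nia.
pose pi (v : 'I_n) : 'I_m := Ordinal (ltn_pmod v m0).
have ltpt (q : 'I_m) (j : 'I_b.+1) : j * m + q < n.
  by have := ltn_ord q; have := ltn_ord j; nia.
pose pt q j : 'I_n := Ordinal (ltpt q j).
have pi_pt q j : pi (pt q j) = q.
  by apply: val_inj; rewrite /= modnMDl modn_small.
have pt_inj q j j' : pt q j = pt q j' -> j = j'.
  move=> /(congr1 val) /= /eqP; rewrite eqn_add2r eqn_pmul2r // => /eqP.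
  exact: val_inj.
have [P [uP hP leP]] := @exists_packing 'I_m r t (ltnW ltr).
pose G := [set e : {set 'I_n} | (#|e| == r) && (pi @: e \in P)].
have GP e : e \in G -> #|e| = r /\ pi @: e \in P by rewrite inE => /andP[/eqP].
have uG : uniform r G by apply/forall_inP => e /GP[->].
have fiber q : #|[set v | pi v == q]| <= k.-1.
  have ltd (v : 'I_n) : v %/ m < k.-1.
    by rewrite ltn_divLR // mulnC (leq_trans (ltn_ord v)).
  rewrite -[X in _ <= X]card_ord -(@card_in_imset _ _ (fun v => Ordinal (ltd v))).
    exact: max_card.
  move=> u v; rewrite !inE => /eqP pu /eqP pv /(congr1 val) /= eqd.
  have /(congr1 val) /= eqm : pi u = pi v by rewrite pu pv.
  by apply: val_inj; rewrite /= (divn_eq u m) (divn_eq v m) eqd eqm.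
have free : ~~ contains_copy H G.
  apply/negP => /(contains_copy_sunflower (ltnW k1) sunH)[B [D [BG cD sD dB]]].
  pose i0 : 'I_k := Ordinal (ltnW k1).
  have cpiD : #|pi @: D| = t.
    have [cB piB] := GP _ (BG i0); rewrite card_in_imset // => u v uD vD.
    have /imset_injP : #|pi @: B i0| == #|B i0| by rewrite (uP _ piB) cB.
    by apply; apply: (subsetP (sD i0)).
  (* The projections are members of [P] sharing the [t] points of [pi @: D], so the packing property
     identifies them. *)
  have piB i : pi @: B i = pi @: B i0.
    have [_ Bi] := GP _ (BG i); have [_ B0] := GP _ (BG i0).
    by apply: hP => //; rewrite -cpiD subset_leq_card // subsetI !imsetS.
  have [q qB qD] : exists2 q, q \in pi @: B i0 & q \notin pi @: D.
    apply/subsetPn; apply/negP => /subset_leq_card.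
    by rewrite cpiD (uP _ (GP _ (BG i0)).2) leqNgt ltr.
  suff : k <= #|[set v | pi v == q]| by have := fiber q; lia.
  apply: leq_card_transversal dB => i.
  have : q \in pi @: B i by rewrite piB.
  case/imsetP => u uB eqq; exists u; rewrite !inE uB eqq eqxx !andbT.
  by apply: contra qD => uD; rewrite eqq imset_f.
have cG : #|P| * b.+1 ^ r <= #|G|.
  rewrite -sum_nat_const -[X in _ <= X]sum1_card.
  rewrite (partition_big (fun e : {set 'I_n} => pi @: e) (fun Q => Q \in P)) /=.
    apply: leq_sum => Q QP; rewrite sum1dep_card.
    rewrite -(uP Q QP) -[b.+1]card_ord -(card_pffun_on ord0 (mem Q) predT).
    set W := pffun_on _ _ _; rewrite -(cardsE W).
    (* [Q] is lifted by choosing one point in each of its classes; since [g] is [ord0] off [Q], the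
       lifted edge determines [g]. *)
    pose ed (g : {ffun 'I_m -> 'I_b.+1}) := [set pt q (g q) | q in Q].
    rewrite -(@card_in_imset _ _ ed).
      apply: subset_leq_card; apply/subsetP => _ /imsetP[g _ ->].
      have piQ : pi @: ed g = Q.
        rewrite -imset_comp -[RHS]imset_id; apply: eq_imset => q.
        by rewrite /= pi_pt.
      rewrite !inE piQ QP eqxx !andbT card_imset ?uP // => q q' eqpt.
      by rewrite -(pi_pt q (g q)) eqpt pi_pt.
    move=> g g'; rewrite !inE => /pffun_onP[/supportP g0 _] /pffun_onP[/supportP g0' _].
    move=> eqed; apply/ffunP => q; case: (boolP (q \in Q)) => qQ; last first.
      by rewrite g0 // g0'.
    have : pt q (g q) \in ed g' by rewrite -eqed; apply: imset_f.
    case/imsetP => q' _ eqpt; have eqq : q = q'.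
      by rewrite -(pi_pt q (g q)) eqpt pi_pt.
    by move: eqpt; rewrite -eqq => /pt_inj.
  by move=> e /GP[].
have leG := leq_turan uG free.
have r0 : 0 < r by lia.
have n0 : 0 < n by lia.
(* The packing bound with [m ^ r <= r ^ r * 'C(m, r)], ['C(r, t) <= 2 ^ r] and
   ['C(m - t, r - t) <= m ^ (r - t)], after cancelling [m ^ (r - t)]. *)
have leP' : m ^ t <= (2 * r) ^ r * #|P|.
  have mrt : 0 < m ^ (r - t) by rewrite expn_gt0 m0.
  rewrite -(leq_pmul2r mrt) -expnD subnKC ?(ltnW ltr) //.
  apply: leq_trans (leq_expn_bin _) _; first by rewrite /m leq_maxl.
  rewrite card_ord in leP; apply: leq_trans (leq_mul (leqnn _) leP) _.
  rewrite expnMn (_ : _ * _ * #|P| * _ = r ^ r * (#|P| * (2 ^ r * m ^ (r - t)))).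
    rewrite leq_mul2l; apply/orP; right; rewrite leq_mul2l; apply/orP; right.
    rewrite leq_mul ?leq_bin_exp2 //; apply: leq_trans (leq_bin_expn _ _) _.
    rewrite leq_exp2r; last by lia.
    exact: leq_subr.
  by ring.
have ler : n ^ r <= (4 * r) ^ r * m ^ (r - t) * #|G|.
  apply: (@leq_trans ((2 * m * b.+1) ^ r)); first by rewrite leq_exp2r.
  rewrite !expnMn -{2}(subnKC (ltnW ltr)) expnD.
  rewrite (_ : 4 ^ r = 2 ^ r * 2 ^ r); last by rewrite -expnMn.
  rewrite (_ : _ * _ * _ = 2 ^ r * m ^ (r - t) * (m ^ t * b.+1 ^ r)); last by ring.
  apply: (@leq_trans (2 ^ r * m ^ (r - t) * ((2 * r) ^ r * #|P| * b.+1 ^ r))).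
    by rewrite leq_mul2l leq_mul2r leP' !orbT.
  rewrite expnMn.
  rewrite (_ : _ * _ * _ = 2 ^ r * 2 ^ r * r ^ r * m ^ (r - t) * (#|P| * b.+1 ^ r)); last by ring.
  by rewrite leq_mul2l cG orbT.
have nrt : 0 < n ^ (r - t) by rewrite expn_gt0 n0.
(* Multiplying by [n ^ (r - t)] makes [ler] applicable; [m * k <= (r + 3) * n] then restores the
   same power of [n] on the right. *)
rewrite -(leq_pmul2r nrt) mulnAC -expnD subnKC ?(ltnW ltr) //.
apply: (leq_trans (leq_mul ler (leqnn _))).
rewrite mulnAC -(mulnA _ (m ^ _)) -expnMn.
apply: (@leq_trans ((4 * r) ^ r * ((r + 3) * n) ^ (r - t) * #|G|)).
  rewrite leq_mul2r; apply/orP; right; rewrite leq_mul2l; apply/orP; right.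
  by rewrite leq_exp2r // subn_gt0.
have leC : (r + 3) ^ (r - t) * #|G| <= (r + 3) ^ r * turan r n H.
  by apply: leq_mul => //; rewrite leq_pexp2l ?leq_subr // addn3.
rewrite (expnMn (r + 3)) (expnMn (4 * r)).
rewrite (_ : _ * #|G| = (4 * r) ^ r * n ^ (r - t) * ((r + 3) ^ (r - t) * #|G|)).
  rewrite [X in _ <= X](_ : _ =
    (4 * r) ^ r * n ^ (r - t) * ((r + 3) ^ r * turan r n H)); last by ring.
  by rewrite leq_mul2l leC orbT.
by ring.
Qed.

(** * The upper bound for the Turán number, and both cases combined *)

Lemma turan_le (T : finType) (r t k n : nat) (H : {set {set T}}) :
  let M := maxn t (r - t).-1 in
  t < r -> 0 < k -> is_sunflower r t k H ->
  turan r n H <= (2 ^ r).+1 ^ (2 ^ r) * (r * r) ^ r * (n ^ M * k ^ (r - M)).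
Proof.
move=> M ltr k0 sunH; apply/bigmax_leqP => G /andP[uG free].
apply: leq_trans (card_sunflower_free ltr k0 sunH uG free) _.
rewrite card_ord -/M -[X in _ <= X]mulnA leq_mul2l; apply/orP; right.
rewrite mulnCA (mulnA r r k) (expnMn (r * r)) leq_mul2l leq_mul2r.
by rewrite leq_pexp2l ?leq_subr ?orbT // muln_gt0; lia.
Qed.

Unset Implicit Arguments.
Local Open Scope ring_scope.

Theorem theorem1 (R : realType) (r : nat) (hr : (1 <= r)%N) :
  exists c C : R, 0 < c /\ 0 < C /\
    forall (t k n : nat) (T : finType) (H : {set {set T}}),
      (t <= r - 1)%N -> (r <= n)%N -> (2 <= k)%N -> (k <= n)%N ->
      is_sunflower r t k H ->
      ((2 * t <= r - 1)%N ->
         c * n%:R ^+ (r - t - 1) * k%:R ^+ (t + 1) <= (turan r n H)%:R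
         /\ (turan r n H)%:R <= C * n%:R ^+ (r - t - 1) * k%:R ^+ (t + 1)) /\
      ((r - 1 < 2 * t)%N ->
         c * n%:R ^+ t * k%:R ^+ (r - t) <= (turan r n H)%:R
         /\ (turan r n H)%:R <= C * n%:R ^+ t * k%:R ^+ (r - t)).
Proof.
(* The sum dominates the constants of both constructions, so [c = 1 / D] serves in either case. *)
pose D := ((4 * r ^ 3) ^ r + (4 * r * (r + 3)) ^ r)%N.
pose E := ((2 ^ r).+1 ^ (2 ^ r) * (r * r) ^ r)%N.
have D0 : (0 < D)%N by rewrite addn_gt0 expn_gt0 muln_gt0 expn_gt0 hr.
have E0 : (0 < E)%N by rewrite muln_gt0 !expn_gt0 muln_gt0 hr.
exists D%:R^-1, E%:R; rewrite invr_gt0 !ltr0n; split=> //; split=> //.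
move=> t k n T H let_r lern k2 lekn sunH.
have ltr : (t < r)%N by lia.
have k1n : (1 < k <= n)%N by rewrite k2.
have to_nat a b : (n ^ a * k ^ b <= D * turan r n H)%N ->
    (turan r n H <= E * (n ^ a * k ^ b))%N ->
    D%:R^-1 * n%:R ^+ a * k%:R ^+ b <= (turan r n H)%:R :> R
    /\ (turan r n H)%:R <= E%:R * n%:R ^+ a * k%:R ^+ b :> R.
  move=> lo up; rewrite -!mulrA -!natrX -!natrM; split; last by rewrite ler_nat.
  by rewrite ler_pdivrMl ?ltr0n // -natrM ler_nat.
have up := turan_le n ltr (ltnW k2) sunH.
have lo1 := turan_ge_heavy ltr lern k1n sunH.
have lo2 := turan_ge_packing ltr lern k1n sunH.
split=> ht; apply: to_nat.
- rewrite -subnDA addn1; apply: leq_trans lo1 _; by rewrite leq_mul2r leq_addr orbT.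
(* The case distinction of the theorem decides which argument of the maximum wins: [r - t - 1] here,
   [t] in the other case. *)
- move: up; rewrite (_ : maxn _ _ = r - t - 1)%N; last by lia.
  by rewrite (_ : r - (r - t - 1) = t + 1)%N //; lia.
- by apply: leq_trans lo2 _; rewrite leq_mul2r leq_addl orbT.
by move: up; rewrite (_ : maxn _ _ = t)%N //; lia.
Qed.
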